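(* Let $f : \mathcal{C}_d \to \mathbb{R}^+ \cup \{\infty\}$ be a monotone function that admits a Helly theorem, approximations by inscribed polytopes, and a fractional Helly theorem. Let $0 < \varepsilon < 1$. Then, given integers $p \ge q \ge F(f,d,\frac{\varepsilon}{2})$, there is a constant $c = c(f,p,q,d,\varepsilon)$ such that for any finite family $\mathcal{F}$ of convex sets in $\mathbb{R}^d$, if out of every $p$ elements of $\mathcal{F}$ there is a $q$-tuple $A$ such that $f(\bigcap A) \ge 1$, then there is a family $\mathcal{T}$ of at most $c$ convex sets $K_1, K_2, \ldots, K_c$ such that $f(K_i) \ge 1-\varepsilon$ for each $i$ and every set in $\mathcal{F}$ contains at least one set in $\mathcal{T}$. Moreover, if $f$ admits sharp versions of the three properties mentioned (Helly theorem, approximations by inscribed polytopes, fractional Helly theorem), then we may take $\varepsilon = 0$ in this statement as well.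
   Context: $\mathbb{R}^+ = \{a \in \mathbb{R} : a \ge 0\}$ and $\mathcal{C}_d$ is the family of convex sets in $\mathbb{R}^d$. For a family $A$ of sets, $\bigcap A$ is the intersection of its members. A function $f : \mathcal{C}_d \to \mathbb{R}^+ \cup \{\infty\}$ is monotone if $A \subset B$ implies $f(A) \le f(B)$. $f$ admits a Helly theorem if, given $1 > \varepsilon > 0$, there is an integer $H(f,d,\varepsilon)$ such that for any finite family $\mathcal{F}$ of convex sets in $\mathbb{R}^d$ and any $\lambda > 0$, if every subfamily $\mathcal{F}'$ of cardinality at most $H(f,d,\varepsilon)$ satisfies $f(\bigcap \mathcal{F}') \ge \lambda$, then $f(\bigcap \mathcal{F}) \ge (1-\varepsilon)\lambda$. $f$ admits approximations by inscribed polytopes (can be approximated by inscribed polytopes) if for every $1 > \varepsilon > 0$ there is a constant $C(f,d,\varepsilon)$ such that for every $\infty > \lambda \ge 0$ and every convex set $K \subset \mathbb{R}^d$ with $f(K) \ge \lambda$, there is a polytope $P \subset K$ with at most $C(f,d,\varepsilon)$ vertices such that $f(P) \ge (1-\varepsilon)\lambda$. $f$ admits a fractional Helly theorem if, given $1 > \varepsilon > 0$, there is an integer $F = F(f,d,\varepsilon)$ such that for any $\alpha > 0$ there is a $\beta = \beta(\alpha,f,d,\varepsilon) > 0$ such that the following holds: given any finite family $\mathcal{F}$ of convex sets in $\mathbb{R}^d$, if there are at least $\alpha\binom{|\mathcal{F}|}{F}$ subsets $A \subset \mathcal{F}$ of cardinality $F$ that satisfy $f(\bigcap A) \ge 1$,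 then there is a subset $\mathcal{F}' \subset \mathcal{F}$ of cardinality at least $\beta|\mathcal{F}|$ such that $f(\bigcap \mathcal{F}') \ge 1-\varepsilon$. For each of these properties, $f$ satisfies a sharp version if the property holds for $\varepsilon = 0$.
   Formalization: Every member K of the family is also required to satisfy f(K) ≥ 1−ε; this is necessary for the conclusion, and without it the claim fails (f(K)=1 if 0∈K, else 0; p=2, q=1; family {{0},∅}). Families may repeat members, counted with multiplicity. *)

(* Defs.v *)
From mathcomp Require Import all_boot all_order all_algebra.
From mathcomp Require Import all_classical all_reals all_analysis.

Set Implicit Arguments.
Unset Strict Implicit.
Unset Printing Implicit Defensive.

Import Order.TTheory GRing.Theory Num.Theory.

Local Open Scope classical_set_scope.
Local Open Scope ring_scope.
Local Open Scope convex_scope.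

Section Defs.
Context {R : realType} {d : nat}.
Local Notation V := (convex_lmodType 'rV[R]_d).

Definition convex_hull (A : set V) : set V := smallest (@convex_set R _) A.

(* The empty set is a polytope, with no vertices. *)
Definition polytope (P : set V) : Prop :=
  exists2 A : set V, finite_set A & P = convex_hull A.

(* The vertices of a polytope are its extreme points. *)
Definition vertices (P : set V) : set V :=
  [set x | P x /\ forall (y z : V) (t : {i01 R}), P y -> P z ->
     0 < t%:num < 1 -> x = y <| t |> z -> y = z].

(* A function on the convex sets of R^d with values in [0, +oo] is encoded as
   a function on all sets: its values on sets that are not convex are
   unconstrained, and every property below only looks at convex sets. *)
Definition nonneg_on_convex (f : set V -> \bar R) : Prop :=
  forall A, convex_set A -> (0 <= f A)%E.

Definition monotone_on_convex (f : set V -> \bar R) : Prop :=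
  forall A B, convex_set A -> convex_set B -> A `<=` B -> (f A <= f B)%E.

(* A finite family of sets is indexed by a finite type I, so repeated members
   count with multiplicity; its subfamilies are the J : {set I}.  The
   intersection of the empty subfamily is the whole space. *)
Definition meet_family (I : finType) (K : I -> set V) (J : {set I}) : set V :=
  \bigcap_(i in [set` J]) K i.

Definition helly_number (f : set V -> \bar R) (eps : R) (H : nat) : Prop :=
  forall (I : finType) (K : I -> set V) (lam : R),
    (forall i, convex_set (K i)) -> 0 < lam ->
    (forall J : {set I}, (#|J| <= H)%N -> (lam%:E <= f (meet_family K J))%E) ->
    (((1 - eps) * lam)%:E <= f (meet_family K [set: I]%SET))%E.

Definition approx_number (f : set V -> \bar R) (eps : R) (C : nat) : Prop :=
  forall (lam : R) (K : set V),
    0 <= lam -> convex_set K -> (lam%:E <= f K)%E ->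
    exists P : set V, [/\ polytope P, P `<=` K, (vertices P #<= `I_C)%card
                        & (((1 - eps) * lam)%:E <= f P)%E].

(* Families with fewer than N members are left out: they have no subset of
   cardinality N, so the density hypothesis would hold vacuously for them and
   the property would force 1 - eps <= f K for every convex set K if N > 1. *)
Definition fractional_helly_number
    (f : set V -> \bar R) (eps : R) (N : nat) : Prop :=
  forall alpha : R, 0 < alpha ->
  exists2 beta : R, 0 < beta &
    forall (I : finType) (K : I -> set V),
      (forall i, convex_set (K i)) -> (N <= #|I|)%N ->
      alpha * 'C(#|I|, N)%:R <=
        #|[set J : {set I} | (#|J| == N) && (1 <= f (meet_family K J))%E]%SET|%:R ->
      exists J : {set I}, beta * #|I|%:R <= #|J|%:R
                          /\ ((1 - eps)%:E <= f (meet_family K J))%E.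

Definition admits_helly f : Prop :=
  forall eps : R, 0 < eps < 1 -> exists H, helly_number f eps H.
Definition admits_approx f : Prop :=
  forall eps : R, 0 < eps < 1 -> exists C, approx_number f eps C.
Definition admits_fractional_helly f : Prop :=
  forall eps : R, 0 < eps < 1 -> exists N, fractional_helly_number f eps N.

Definition admits_sharp_helly f : Prop := exists H, helly_number f 0 H.
Definition admits_sharp_approx f : Prop := exists C, approx_number f 0 C.
Definition admits_sharp_fractional_helly f : Prop :=
  exists N, fractional_helly_number f 0 N.

Definition pq_condition (f : set V -> \bar R) (p q : nat)
    (I : finType) (K : I -> set V) : Prop :=
  forall J : {set I}, #|J| = p ->
    exists A : {set I}, [/\ A \subset J, #|A| = q
                          & (1 <= f (meet_family K A))%E].

Definition has_transversal (f : set V -> \bar R) (eps : R) (c : nat)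
    (I : finType) (K : I -> set V) : Prop :=
  exists (m : nat) (T : 'I_m -> set V),
    [/\ (m <= c)%N,
        forall j, convex_set (T j) /\ ((1 - eps)%:E <= f (T j))%E
      & forall i, exists j, T j `<=` K i].

(* The condition 1 - eps <= f (K i) is implied, through monotonicity, by the
   existence of a transversal, and the (p, q) condition alone does not give it:
   for p > q, a family may contain up to p - q sets, such as the empty set, on
   which f vanishes. *)
Definition pq_property (f : set V -> \bar R) (eps : R) (p q : nat) : Prop :=
  exists c : nat, forall (I : finType) (K : I -> set V),
    (forall i, convex_set (K i)) ->
    (forall i, ((1 - eps)%:E <= f (K i))%E) ->
    pq_condition f p q K ->
    has_transversal f eps c K.

End Defs.

(* Main.v *)
Require Import Defs.
From mathcomp Require Import all_boot all_order all_algebra.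
From mathcomp Require Import all_classical all_reals all_analysis.
From mathcomp Require Import lra ring zify.

(** The proof follows the scheme of Alon and Kleitman: a fractional transversal
    is found first, and a weak net then turns it into a bounded transversal.

    Repeating members shows that fractional Helly also holds for weighted
    families: whatever weights are put on the members with [f] at least 1, a
    fixed part [beta] of the weight is on members whose meet has [f] at least
    [1 - eta] ([weighted_fractional_helly]). Applying this repeatedly, and
    halving each time the weights of the members found, yields a finite list of
    such meets of which every member with [f] at least 1 contains a fixed part
    [1 / m] ([fractional_cover]). It remains to find a bounded number of convex
    sets, with [f] only slightly smaller, such that every convex set containing
    a [1 / m] part of the list contains one of them ([weak_net]).

    Fractional Helly cannot serve for the weak net, since it is only assumed at
    the threshold 1. Helly's property and the inscribed polytopes suffice. By
    Helly's property, the hulls of all subfamilies that omit few sets have a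
    common part with large [f] ([centre]); it contains a large polytope with a
    bounded number of vertices. Each of these vertices is in the hull of every
    subfamily omitting few sets, and a counting argument due to Clarkson, based
    on the nearest point of a hull, shows that it is then in the hulls of most
    samples of a suitable bounded size ([few_samples_miss]). So the polytope
    itself is in the hulls of at least half of the samples ([selection]), and
    the greedy construction of a weak net applies.

    Helly's property is used once and the approximation property twice, each
    with a relative loss [del], whatever [m] is; this is why [del] may be fixed
    before [m] is known. With [del = eta = 0] the same argument gives the sharp
    version. *)

Set Implicit Arguments.
Unset Strict Implicit.
Unset Printing Implicit Defensive.

Import Order.TTheory GRing.Theory Num.Theory numFieldNormedType.Exports.

Local Open Scope classical_set_scope.
Local Open Scope ring_scope.

(** * Convex hulls and Caratheodory's theorem *)

Section ConvexHull.
Context {R : realType} {d : nat}.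
Local Notation E := 'rV[R]_d.
Implicit Types (A B : set E) (x y z p : E).

Lemma convexP A : @convex_set R E A <->
  forall x y (t : R), A x -> A y -> 0 <= t <= 1 -> A (t *: x + (1 - t) *: y).
Proof.
split=> [cA x y t Ax Ay t01|cA x y t /set_mem Ax /set_mem Ay].
  have tP : Itv.spec (@Itv.num_sem R) (Itv.Real `[0%Z, 1%Z]) t.
    by rewrite /= /Itv.num_sem /= in_itv /= t01 num_real.
  by have /set_mem := cA x y (Itv.mk tP) (mem_set Ax) (mem_set Ay).
by apply/mem_set/cA => //; rewrite ge0 le1.
Qed.

Lemma hull_sub A : A `<=` convex_hull A.
Proof. exact: sub_gen_smallest. Qed.

Lemma hull_min A B : @convex_set R E B -> A `<=` B -> convex_hull A `<=` B.
Proof. exact: smallest_sub. Qed.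

Lemma convex_setT : @convex_set R E setT.
Proof. by apply/convexP. Qed.

Lemma convex_set0 : @convex_set R E set0.
Proof. by apply/convexP. Qed.

Lemma convex_bigcap (I : Type) (D : set I) (F : I -> set E) :
  (forall i, D i -> @convex_set R E (F i)) -> @convex_set R E (\bigcap_(i in D) F i).
Proof.
move=> cF; apply/convexP => x y t Fx Fy t01 i Di.
by move/convexP: (cF i Di); apply => //; [exact: Fx | exact: Fy].
Qed.

Lemma convex_convex_hull A : @convex_set R E (convex_hull A).
Proof. by apply: convex_bigcap => B []. Qed.
Arguments convex_convex_hull A : clear implicits.

Lemma sub_hull A B : A `<=` B -> @convex_hull R d A `<=` convex_hull B.
Proof.
by move=> AB; apply: hull_min (convex_convex_hull B) _ => x /AB; exact: hull_sub.
Qed.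

(** The partial sums are kept in the form weight times point of [A], which
    avoids dividing by a total weight that may vanish. *)
Lemma convex_sum A (I : finType) (a : I -> R) (x : I -> E) :
    @convex_set R E A -> (forall i, 0 <= a i) -> \sum_i a i = 1 ->
    (forall i, a i != 0 -> A (x i)) -> A (\sum_i a i *: x i).
Proof.
move=> cA a0 a1 Ax.
have [i0 ai0] : exists i, a i != 0.
  apply: contrapT => /forallNP aN; move: a1; rewrite big1 => [/esym/eqP|i _].
    by rewrite oner_eq0.
  by apply/eqP/negPn/negP/aN.
have sumA (s : seq I) : exists2 y, A y &
    \sum_(i <- s) a i *: x i = (\sum_(i <- s) a i) *: y.
  elim: s => [|i s [y Ay IH]].
    by exists (x i0); [exact: Ax | rewrite !big_nil scale0r].
  have S0 : 0 <= \sum_(j <- s) a j by apply: sumr_ge0.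
  rewrite !big_cons IH; set S := \sum_(j <- s) a j in S0 *.
  have [ai|ai] := eqVneq (a i) 0; first by exists y; rewrite // ai scale0r !add0r.
  have W0 : 0 < a i + S by apply: ltr_pwDl; rewrite // lt_def ai a0.
  exists ((a i / (a i + S)) *: x i + (1 - a i / (a i + S)) *: y).
    move/convexP: cA; apply=> //; first exact: Ax.
    apply/andP; split; first by rewrite divr_ge0 ?a0 ?ltW.
    by rewrite ler_pdivrMr // mul1r lerDl.
  rewrite scalerDr !scalerA; congr (_ *: _ + _ *: _).
    by rewrite mulrCA divff ?mulr1 ?gt_eqF.
  by field; rewrite gt_eqF.
by have [y Ay] := sumA (index_enum I); rewrite a1 scale1r => ->.
Qed.

Definition is_comb A (I : finType) (a : I -> R) (x : I -> E) p : Prop :=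
  [/\ forall i, 0 <= a i, \sum_i a i = 1, forall i, a i != 0 -> A (x i)
    & p = \sum_i a i *: x i].

(** Convex combinations of points of [A], over all finite index types at once,
    form a convex set containing [A]. *)
Lemma hull_comb A p : @convex_hull R d A p ->
  exists (I : finType) (a : I -> R) (x : I -> E), is_comb A a x p.
Proof.
pose B : set E := [set p | exists (I : finType) (a : I -> R) (x : I -> E), is_comb A a x p].
move: p; suff: convex_hull A `<=` B by [].
apply: hull_min; last first.
  move=> x Ax; exists unit, (fun=> 1), (fun=> x).
  by split=> // [|]; rewrite big_const card_unit /= ?addr0 ?scale1r.
apply/convexP => p q t [I [a [x [a0 a1 Ax ->]]]] [J [b [y [b0 b1 By ->]]]] /andP[t0 t1].
exists (I + J)%type,
  (fun k => match k with inl i => t * a i | inr j => (1 - t) * b j end),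
  (fun k => match k with inl i => x i | inr j => y j end).
split.
- by case=> i; rewrite mulr_ge0 ?subr_ge0.
- by rewrite big_sumType /= -!mulr_sumr a1 b1; ring.
- by case=> i; rewrite mulf_eq0 negb_or => /andP[_]; [exact: Ax | exact: By].
- rewrite big_sumType /= !scaler_sumr.
  by congr (_ + _); apply: eq_bigr => i _; rewrite scalerA.
Qed.

Definition supp (I : finType) (a : I -> R) : {set I} := [set i | a i != 0]%SET.

(** Among more than [d + 1] points of [R^d] there is an affine dependence; it
    is a vector in the kernel of the matrix of the points with a column of ones
    added. *)
Lemma affine_dependence (I : finType) (S : {set I}) (x : I -> E) :
  (d.+1 < #|S|)%N -> exists b : I -> R,
    [/\ forall i, i \notin S -> b i = 0, \sum_i b i = 0,
        \sum_i b i *: x i = 0 & exists i, 0 < b i].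
Proof.
move=> ltS; pose n := #|S|.
pose M : 'M[R]_(n, d + 1) :=
  row_mx (\matrix_(i < n, j < d) x (enum_val i) 0 j) (const_mx 1).
have kM : kermx M != 0.
  rewrite -mxrank_eq0 mxrank_ker subn_eq0 -ltnNge.
  by rewrite (leq_ltn_trans (rank_leq_col M)) // addn1.
have [k /negP kk] : exists k, ~ (row k (kermx M) == 0).
  apply: contrapT => /forallNP h; case/eqP: kM; apply/row_matrixP => k.
  by rewrite row0; apply/eqP; exact: (contrapT (h k)).
set v := row k (kermx M) in kk.
have vM : v *m M = 0 by rewrite -row_mul mulmx_ker row0.
pose b' (i : I) : R := \sum_(j < n | enum_val j == i) v 0 j.
have sumb (V : lmodType R) (y : I -> V) :
    \sum_i b' i *: y i = \sum_(j < n) v 0 j *: y (enum_val j).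
  rewrite (partition_big (fun j : 'I_n => enum_val j) predT) //=.
  apply: eq_bigr => i _; rewrite scaler_suml.
  by apply: eq_bigr => j /eqP <-.
have b'0 i : i \notin S -> b' i = 0.
  move=> iS; rewrite /b' big_pred0 // => j; apply/negP => /eqP ji.
  by move: iS; rewrite -ji enum_valP.
have b's : \sum_i b' i = 0.
  have := sumb R^o (fun=> 1); under eq_bigr do rewrite /GRing.scale /= mulr1.
  move=> ->; move/matrixP: vM => /(_ 0 (rshift d 0)); rewrite !mxE; apply: etrans.
  by apply: eq_bigr => j _; rewrite row_mxEr !mxE.
have b'x : \sum_i b' i *: x i = 0.
  rewrite sumb; apply/rowP => l; rewrite summxE mxE.
  move/matrixP: vM => /(_ 0 (lshift 1 l)); rewrite !mxE; apply: etrans.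
  by apply: eq_bigr => j _; rewrite row_mxEl !mxE.
exists b'; split=> //; apply: contrapT => /forallNP bN.
have {}bN i : b' i <= 0 by rewrite leNgt; apply/negP/bN.
move: kk; apply/negP/negPn/eqP/rowP => j; rewrite [RHS]mxE.
have : - b' (enum_val j) = 0.
  apply/eqP; have /eqP := b's; rewrite -oppr_eq0 -sumrN psumr_eq0.
    by move=> /allP/(_ (enum_val j) (mem_index_enum _)).
  by move=> i _; rewrite oppr_ge0.
rewrite /b' (big_pred1 j) => [/eqP|i]; first by rewrite oppr_eq0 => /eqP.
by rewrite (inj_eq enum_val_inj).
Qed.

(** A combination with more than [d + 1] nonzero weights is shortened by sliding
    the weights along an affine dependence until the first of them vanishes. *)
Lemma caratheodory_comb A p : @convex_hull R d A p ->
  exists (I : finType) (a : I -> R) (x : I -> E),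
    is_comb A a x p /\ (#|supp a| <= d.+1)%N.
Proof.
move=> /hull_comb[I [a [x]]]; have [n] := ubnP #|supp a|.
elim: n a => // n IH a ltn [a0 a1 Ax ap].
have [leS|ltS] := leqP #|supp a| d.+1; first by exists I, a, x.
have [b [bS b1 bx [i0 bi0]]] := affine_dependence x ltS.
have [i bi mini] := arg_minP (fun i => a i / b i) (P := fun i => 0 < b i) bi0.
pose t := a i / b i.
have t0 : 0 <= t by rewrite divr_ge0 ?a0 // ltW.
pose a' j := a j - t * b j.
have sub j : a' j != 0 -> a j != 0.
  apply: contraNneq => aj; rewrite /a' aj bS ?mulr0 ?subr0 //.
  by rewrite inE aj eqxx.
apply: (IH a').
  rewrite ltnS in ltn; apply: leq_trans _ ltn.
  apply/proper_card/properP; split.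
    by apply/fintype.subsetP => j; rewrite !inE; exact: sub.
  exists i; last by rewrite !inE negbK /a' /t divfK ?subrr // gt_eqF.
  by rewrite inE; apply: contraTneq bi => ai; rewrite bS ?ltxx // inE ai eqxx.
split.
- move=> j; rewrite subr_ge0; have [bj|bj] := ltP 0 (b j).
    by rewrite -ler_pdivlMr // mini.
  by rewrite (le_trans _ (a0 j)) // mulr_ge0_le0.
- by rewrite sumrB -mulr_sumr b1 mulr0 subr0.
- by move=> j /sub /Ax.
- under eq_bigr do rewrite scalerBl -scalerA.
  by rewrite sumrB -scaler_sumr bx scaler0 subr0.
Qed.

Lemma caratheodory A p : @convex_hull R d A p ->
  exists s : seq E, [/\ (size s <= d.+1)%N, [set` s] `<=` A
                      & @convex_hull R d [set` s] p].
Proof.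
move=> /caratheodory_comb[I [a [x [[a0 a1 Ax ->] leS]]]].
exists [seq x i | i <- enum (supp a)]; split.
- by rewrite size_map -cardE.
- move=> y /= /mapP[i]; rewrite mem_enum inE => ai ->; exact: Ax.
- apply: convex_sum => //; first exact: (convex_convex_hull _).
  by move=> i ai; apply: hull_sub => /=; rewrite map_f // mem_enum inE.
Qed.

Lemma hull_set0 : @convex_hull R d set0 = set0.
Proof. by apply/seteqP; split=> //; exact: hull_min convex_set0 _. Qed.

End ConvexHull.
Arguments convex_convex_hull {R d} A.
Arguments convex_setT {R d}.
Arguments convex_set0 {R d}.

(** * Nearest points *)

Section NearestPoint.
Context {R : realType} {d : nat}.
Local Notation E := 'rV[R]_d.
Implicit Types (A B S : set E) (x y z p : E).

Definition dot x y : R := \sum_k x 0 k * y 0 k.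

Lemma dotC x y : dot x y = dot y x.
Proof. by apply: eq_bigr => k _; rewrite mulrC. Qed.

Lemma dotDl x y z : dot (x + y) z = dot x z + dot y z.
Proof. by rewrite /dot -big_split; apply: eq_bigr => k _; rewrite mxE mulrDl. Qed.

Lemma dotZl a x y : dot (a *: x) y = a * dot x y.
Proof. by rewrite /dot mulr_sumr; apply: eq_bigr => k _; rewrite mxE mulrA. Qed.

Lemma dotNl x y : dot (- x) y = - dot x y.
Proof. by rewrite -scaleN1r dotZl mulN1r. Qed.

Lemma dotDr x y z : dot z (x + y) = dot z x + dot z y.
Proof. by rewrite !(dotC z) dotDl. Qed.

Lemma dotZr a x y : dot y (a *: x) = a * dot y x.
Proof. by rewrite !(dotC y) dotZl. Qed.

Lemma dotNr x y : dot y (- x) = - dot y x.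
Proof. by rewrite !(dotC y) dotNl. Qed.

Lemma dot_ge0 x : 0 <= dot x x.
Proof. by apply: sumr_ge0 => k _; rewrite -expr2 sqr_ge0. Qed.

Lemma dot_eq0 x : dot x x = 0 -> x = 0.
Proof.
move=> /eqP; rewrite psumr_eq0 => [/allP x0|k _]; last by rewrite -expr2 sqr_ge0.
apply/rowP => k; rewrite mxE; apply/eqP.
by have := x0 k (mem_index_enum _); rewrite mulf_eq0 orbb.
Qed.

Definition nearest z S p : Prop :=
  S p /\ forall y, S y -> dot (p - z) (p - z) <= dot (y - z) (y - z).

(** Moving from the nearest point [p] towards [x] cannot decrease the distance
    to [z], so the derivative of the squared distance at [p] is nonnegative:
    [S] lies beyond the hyperplane through [p] orthogonal to [p - z]. *)
Lemma nearest_halfspace z S p x : @convex_set R E S -> nearest z S p -> S x ->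
  dot (p - z) (p - z) <= dot (p - z) (x - z).
Proof.
move=> /convexP cS [Sp minp] Sx.
set u := p - z; set v := x - z.
have minuv t : 0 <= t <= 1 -> dot u u <= dot (u + t *: (v - u)) (u + t *: (v - u)).
  move=> t01; have := minp _ (cS x p t Sx Sp t01).
  congr (_ <= dot _ _); apply/rowP => k; rewrite !mxE; ring.
clearbody u v.
have key t : 0 <= t <= 1 ->
    0 <= 2 * t * (dot u v - dot u u) + t ^+ 2 * dot (v - u) (v - u).
  move=> /minuv; rewrite !(dotDl, dotDr, dotZl, dotZr, dotNl, dotNr) (dotC v u).
  by rewrite -subr_ge0; congr (_ <= _); ring.
rewrite -subr_ge0 leNgt; apply/negP => neg.
set D := dot (v - u) (v - u) in key.
have D0 : 0 <= D by exact: dot_ge0.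
set c := dot u v - dot u u in key neg.
have c0 : 0 < D - c by rewrite subr_gt0 (lt_le_trans neg).
(* The quadratic function of [t] in [key] is negative for small positive [t];
   this [t] is small enough, and is at most 1 whatever [D >= 0] is. *)
pose t := - c / (D - c).
have t0 : 0 < t by rewrite divr_gt0 // oppr_gt0.
have t1 : t <= 1 by rewrite ler_pdivrMr // mul1r; lra.
have := key t; rewrite t1 ltW // => /(_ isT).
have tD : t * D <= - c by rewrite /t mulrAC ler_pdivrMr //; nra.
have -> : 2 * t * c + t ^+ 2 * D = t * (2 * c + t * D) by ring.
by rewrite pmulr_rge0 //; lra.
Qed.

Lemma nearest_unique z S p q : @convex_set R E S ->
  nearest z S p -> nearest z S q -> p = q.
Proof.
move=> cS np nq; apply/eqP; rewrite -subr_eq0; apply/eqP/dot_eq0.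
have h1 := nearest_halfspace cS np nq.1; have h2 := nearest_halfspace cS nq np.1.
apply/eqP; rewrite eq_le dot_ge0 andbT.
have -> : p - q = (p - z) - (q - z) by apply/rowP => k; rewrite !mxE; ring.
move: (p - z) (q - z) h1 h2 => u v.
rewrite !(dotDl, dotDr, dotNl, dotNr) (dotC v u); lra.
Qed.

Lemma nearestS z S S' p : S `<=` S' -> S p -> nearest z S' p -> nearest z S p.
Proof. by move=> SS' Sp [_ minp]; split=> // y /SS'; exact: minp. Qed.

(** The weight vectors are taken as row vectors, so that the hull of a finite set
    becomes the image of a compact subset of a normed space. *)
Lemma hull_seq (s : seq E) p : @convex_hull R d [set` s] p ->
  exists2 a : 'rV[R]_(size s), (forall i, 0 <= a 0 i) /\ \sum_i a 0 i = 1
    & p = \sum_i a 0 i *: s`_i.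
Proof.
pose B : set E := [set p | exists2 a : 'rV[R]_(size s),
  (forall i, 0 <= a 0 i) /\ \sum_i a 0 i = 1 & p = \sum_i a 0 i *: s`_i].
move: p; suff: convex_hull [set` s] `<=` B by [].
apply: hull_min => [|x /= xs].
  apply/convexP => x y t [a [a0 a1] ->] [b [b0 b1] ->] /andP[t0 t1].
  exists (t *: a + (1 - t) *: b); first split.
  - by move=> i; rewrite !mxE addr_ge0 // mulr_ge0 ?subr_ge0.
  - under eq_bigr do rewrite !mxE.
    by rewrite big_split -!mulr_sumr a1 b1 /=; ring.
  - rewrite !scaler_sumr -big_split; apply: eq_bigr => i _.
    by rewrite [LHS]/= !scalerA -scalerDl !mxE.
have lt : (index x s < size s)%N by rewrite index_mem.
exists (delta_mx 0 (Ordinal lt)); first split.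
- by move=> i; rewrite mxE eqxx; case: eqP.
- rewrite (bigD1 (Ordinal lt)) //= big1 => [|i ne].
    by rewrite mxE !eqxx addr0.
  by rewrite mxE eqxx (negPf ne).
- rewrite (bigD1 (Ordinal lt)) //= big1 => [|i ne].
    by rewrite mxE !eqxx addr0 scale1r nth_index.
  by rewrite mxE eqxx (negPf ne) scale0r.
Qed.

Lemma continuous_affine (T : topologicalType) n (h : 'I_n -> T -> R) (c : 'I_n -> R) e :
  (forall i, continuous (h i)) -> continuous (fun t => \sum_i h i t * c i - e : R).
Proof.
move=> hc; have cs : continuous (fun t => \sum_i h i t * c i : R).
  apply: continuous_big => [|i _ t]; first exact: add_continuous.
  by apply: cvgM; [exact: hc | exact: cvg_cst].
by move=> t; apply: cvgB; [exact: cs | exact: cvg_cst].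
Qed.

Lemma continuous_sqr_norm (T : topologicalType) n (h : 'I_n -> T -> R) :
  (forall i, continuous (h i)) -> continuous (fun t => \sum_i h i t * h i t : R).
Proof.
move=> hc; apply: continuous_big => [|i _ t]; first exact: add_continuous.
by apply: cvgM; exact: hc.
Qed.

Lemma simplex_compact n :
  compact [set a : 'rV[R]_n | (forall i, 0 <= a 0 i) /\ \sum_i a 0 i = 1].
Proof.
have csum : continuous (fun a : 'rV[R]_n => \sum_i a 0 i).
  apply: continuous_big => [|i _]; first exact: add_continuous.
  exact: coord_continuous.
apply: (@subclosed_compact _ _ [set a : 'rV[R]_n | forall i, `[0, 1]%classic (a ord0 i)]).
- rewrite [X in closed X](_ : _ = (\bigcap_(i in setT) ((fun a : 'rV[R]_n => a 0 i) @^-1` [set x | 0 <= x])) `&`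
    ((fun a : 'rV[R]_n => \sum_i a 0 i) @^-1` [set x | x = 1])).
    apply: closedI; last by apply: preimage_closed => [a _|]; [exact: csum | exact: closed_eq].
    apply: closed_bigI => i _; apply: preimage_closed => [a _|].
      exact: coord_continuous.
    exact: closed_ge.
  by apply/seteqP; split=> [a [a0 a1]|a [a0 a1]]; split=> // i;
      [move=> _; exact: a0 | exact: (a0 i I)].
- exact: (@rV_compact R n (fun=> `[0, 1]%classic) (fun=> @segment_compact R 0 1)).
- move=> a [a0 a1] i /=; rewrite in_itv /= a0 /= -a1 (bigD1 i) //= lerDl.
  by apply: sumr_ge0.
Qed.

Lemma nearest_exists z A : finite_set A -> A !=set0 ->
  exists p, nearest z (convex_hull A) p.
Proof.
move=> /finite_seqP[s ->] [x0 xs].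
pose g (a : 'rV[R]_(size s)) : E := \sum_i a 0 i *: s`_i.
pose F a := dot (g a - z) (g a - z).
have cF : continuous F.
  apply: continuous_sqr_norm => k.
  rewrite [X in continuous X](_ : _ =
      fun a : 'rV[R]_(size s) => \sum_i a 0 i * (s`_i) 0 k - z 0 k).
    by apply: continuous_affine => i; exact: coord_continuous.
  apply/funext => a; rewrite !mxE summxE; congr (_ - _).
  by apply: eq_bigr => i _; rewrite mxE.
have [|a /set_mem [a0 a1] mina] :=
  EVT_min_rV _ (@simplex_compact (size s)) (continuous_subspaceT cF).
  have [b b01 _] := hull_seq (@hull_sub _ _ _ _ xs).
  by exists b.
exists (g a); split.
  apply: convex_sum a0 a1 _; first exact: (convex_convex_hull _).
  by move=> i _; apply: hull_sub; rewrite /= mem_nth.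
by move=> y /hull_seq[b b01 ->]; exact: (mina b (mem_set b01)).
Qed.

End NearestPoint.

(** * Polytopes and their extreme points *)

Section ExtremePoints.
Context {R : realType} {d : nat}.
Local Notation E := 'rV[R]_d.
Implicit Types (A B S : set E) (x y z p : E).

Lemma sub_comb (I : finType) (a : I -> R) (v : I -> E) x :
  \sum_i a i = 1 -> \sum_i a i *: v i - x = \sum_i a i *: (v i - x).
Proof.
move=> a1; rewrite -[in LHS](scale1r x) -a1 scaler_suml -sumrB.
by apply: eq_bigr => i _; rewrite scalerBr.
Qed.

(** A convex combination in which [x] has weight [1 - c] lies at the
    fraction [c] of the segment from [x] to a combination of the other points. *)
Lemma hull_cone A x p : @convex_hull R d A p -> p = x \/
  exists c b, [/\ 0 < c, convex_hull (A `\ x) b & p - x = c *: (b - x)].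
Proof.
move=> /hull_comb[I [a [v [a0 a1 Av ->]]]].
pose c : R := \sum_(i | v i != x) a i.
have px : \sum_i a i *: v i - x = \sum_(i | v i != x) a i *: (v i - x).
  rewrite sub_comb // [RHS]big_mkcond; apply: eq_bigr => i _; case: eqVneq => [->|//].
  by rewrite subrr scaler0.
have [c0|c0] := eqVneq c 0.
  left; apply/eqP; rewrite -subr_eq0 px big1 // => i vi.
  have /eqP := c0; rewrite psumr_eq0 // => /allP/(_ i (mem_index_enum _)).
  by rewrite vi => /eqP ->; rewrite scale0r.
have {}c0 : 0 < c by rewrite lt_def c0 sumr_ge0.
pose a' i := if v i != x then a i / c else 0.
have a'1 : \sum_i a' i = 1 by rewrite -big_mkcond /= -mulr_suml divff ?gt_eqF.
right; exists c, (\sum_i a' i *: v i); split=> //.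
  apply: convex_sum a'1 _; first exact: convex_convex_hull.
    by move=> i; rewrite /a'; case: ifP => // _; rewrite divr_ge0 // ltW.
  move=> i; rewrite /a'; case: ifPn => [/eqP vix|_]; last by rewrite eqxx.
  by rewrite mulf_eq0 negb_or => /andP[ai _]; apply: hull_sub; split=> //; exact: Av.
rewrite px sub_comb // scaler_sumr [LHS]big_mkcond /=; apply: eq_bigr => i _.
rewrite /a'; case: ifP => _; last by rewrite scale0r scaler0.
by rewrite scalerA mulrCA divff ?mulr1 // gt_eqF.
Qed.

(** If [x] is inside a segment of the hull, both ends of the segment are seen
    from [x] in the direction of points of the hull of the rest, by [hull_cone],
    and [x] lies between these two points. *)
Lemma hull_remove A x : @convex_hull R d A x ->
  ~ vertices (convex_hull A) x -> convex_hull (A `\ x) x.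
Proof.
move=> Ax nvx.
have [y [z [t [Ay Az t01 xE yz]]]] : exists y z (t : R), [/\ convex_hull A y,
    convex_hull A z, 0 < t < 1, x = t *: y + (1 - t) *: z & y != z].
  apply: contrapT => nex; apply: nvx; split=> // y z t Ay Az t01 xE.
  by apply: contrapT => /eqP yz; apply: nex; exists y, z, t%:num.
have /andP[t0 t1] := t01.
have e0 : t *: (y - x) + (1 - t) *: (z - x) = 0.
  apply/rowP => k; have := congr1 (fun w : E => w 0 k) xE; rewrite /= !mxE; lra.
have [yx|[c [b [c0 Bb yb]]]] := hull_cone x Ay.
  move: e0 => /eqP; rewrite yx subrr scaler0 add0r scaler_eq0 subr_eq0 (gt_eqF t1) /=.
  by rewrite subr_eq0 => /eqP zx; rewrite yx zx eqxx in yz.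
have [zx|[c' [b' [c'0 Bb' zb]]]] := hull_cone x Az.
  move: e0 => /eqP; rewrite zx subrr scaler0 addr0 scaler_eq0 (gt_eqF t0) /=.
  by rewrite subr_eq0 => /eqP yx; rewrite yx zx eqxx in yz.
have u0 : 0 < t * c by rewrite mulr_gt0.
have v0 : 0 < (1 - t) * c' by rewrite mulr_gt0 // subr_gt0.
rewrite yb zb !scalerA in e0; move: (t * c) ((1 - t) * c') u0 v0 e0 => u v u0 v0 e0.
have uv0 : 0 < u + v by rewrite addr_gt0.
have xE' : x = (u / (u + v)) *: b + (1 - u / (u + v)) *: b'.
  apply/rowP => k; have := congr1 (fun w : E => w 0 k) e0; rewrite /= !mxE => e.
  have uv : u + v != 0 by rewrite gt_eqF.
  apply: (mulfI uv); rewrite [RHS](_ : _ = u * b 0 k + v * b' 0 k); last by field.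
  lra.
rewrite [X in convex_hull _ X]xE'.
move/convexP: (convex_convex_hull (A `\ x)); apply=> //.
apply/andP; split; first by rewrite divr_ge0 ?ltW.
by rewrite ler_pdivrMr // mul1r lerDl ltW.
Qed.

(** The approximation property counts extreme points, whereas the proof needs
    few generating points. Generators that are not extreme can be discarded one
    at a time, by [hull_remove]. *)
Lemma polytope_hull_seq (P : set E) (C : nat) : polytope P ->
  (vertices P #<= `I_C)%card ->
  exists2 s : seq E, (size s <= C)%N & P = convex_hull [set` s].
Proof.
move=> [A /finite_seqP[s0 ->] ->] leC.
suff {s0 leC} : forall n (s : seq E), (size s <= n)%N ->
    (vertices (convex_hull [set` s]) #<= `I_C)%card ->
  exists2 s' : seq E, (size s' <= C)%N & convex_hull [set` s] = @convex_hull R d [set` s'].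
  by move=> /(_ _ s0 (leqnn _) leC).
elim=> [[|//] _ _|n IH s les leC]; first by exists [::].
have [allv|] := pselect (forall x, x \in s -> vertices (convex_hull [set` s]) x).
  have sC : ([set` s] #<= `I_C)%card by apply: (card_le_trans _ leC); apply: subset_card_le => x; exact: allv.
  exists (finmap.enum_fset (fset_set [set` s])); first exact: geq_card_fset_set.
  by congr convex_hull; rewrite -[LHS]fset_setK //; exact: finite_seq.
move=> /existsNP[x /not_implyP[xs nvx]].
have remE : [set` s] `\ x = [set` [seq y <- s | y != x]].
  apply/seteqP; split=> y /=; rewrite mem_filter.
    by move=> [ys /eqP yx]; apply/andP.
  by move=> /andP[/eqP].
have hE : convex_hull [set` s] = @convex_hull R d [set` [seq y <- s | y != x]].
  rewrite -remE; apply/seteqP; split; last by apply: sub_hull => y [].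
  apply: hull_min; [exact: convex_convex_hull | move=> y ys].
  have [->|/eqP yx] := eqVneq y x; last exact: hull_sub.
  by apply: hull_remove nvx; exact: hull_sub.
rewrite hE; apply: IH; last by rewrite -hE.
rewrite size_filter -ltnS; apply: leq_trans les.
by rewrite -(count_predC (pred1 x) s) -[ltnLHS]add0n ltn_add2r -has_count has_pred1.
Qed.
End ExtremePoints.

(** * Random samples of a family of finite sets *)

Section Sampling.
Context {R : realType} {d : nat}.
Local Notation E := 'rV[R]_d.
Variables (T : finType) (X : T -> set E) (z : E).
Hypothesis finX : forall t, finite_set (X t).

Definition sample_hull N (h : {ffun 'I_N -> T}) : set E :=
  convex_hull (\bigcup_i X (h i)).

(** Adding [X t] to the sample creates a new nearest point to [z]. The
    point is required to exist because a hull is empty if all the sets are. *)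
Definition violates N (h : {ffun 'I_N -> T}) (t : T) : bool :=
  `[< exists2 p, nearest z (convex_hull ((\bigcup_i X (h i)) `|` X t)) p
               & ~ sample_hull h p >].

(** Suppose that the hull of the sample misses [z], and let [p] be its point
    nearest to [z]. The sets that leave [p] nearest all lie in a halfspace that
    excludes [z]; as the hull of any subfamily omitting few sets contains [z],
    there cannot be too many of them. *)
Lemma violators_many (H N : nat) (h : {ffun 'I_N -> T}) :
  (forall G : {set T}, (H * #|~: G| < #|T|)%N ->
     convex_hull (\bigcup_(t in [set` G]) X t) z) ->
  ~ sample_hull h z -> (#|T| <= H * #|[set t | violates h t]%SET|)%N.
Proof.
move=> deep nhz; rewrite leqNgt; apply/negP => few.
have finh : finite_set (\bigcup_i X (h i)) 
  by apply: bigcup_finite => [|i _]; [exact: finite_finset | exact: finX].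
have nearu t : X t !=set0 -> exists2 p,
    nearest z (convex_hull ((\bigcup_i X (h i)) `|` X t)) p
    & ~~ violates h t -> sample_hull h p.
  move=> [x Xx]; have [||p np] := @nearest_exists _ _ z ((\bigcup_i X (h i)) `|` X t).
  - by rewrite finite_setU; split.
  - by exists x; right.
  exists p => // nv; apply: contrapT => nhp; move/negP: nv; apply.
  by apply/asboolP; exists p.
suff [Q [cQ nQz subQ]] : exists Q : set E, [/\ @convex_set R E Q, ~ Q z &
    forall t, ~~ violates h t -> X t `<=` Q].
  apply: nQz; pose G := (~: [set t | violates h t])%SET.
  have /deep : (H * #|~: G| < #|T|)%N by rewrite /G finset.setCK.
  by apply: (hull_min cQ) => x [t /=]; rewrite !inE => nv; exact: subQ.
have [h0|/set0P/negP/negPn/eqP h0] := pselect (\bigcup_i X (h i) !=set0); last first.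
  exists set0; split; [exact: convex_set0 | by [] |].
  move=> t nv x Xx; have [|p _ /(_ nv)] := nearu t; first by exists x.
  by rewrite /sample_hull h0 hull_set0.
have [p np] := nearest_exists z finh h0.
have pz : 0 < dot (p - z) (p - z).
  rewrite lt_def dot_ge0 andbT; apply/eqP => /dot_eq0/eqP.
  by rewrite subr_eq0 => /eqP pz; apply: nhz; rewrite -pz; case: np.
exists [set x | dot (p - z) (p - z) <= dot (p - z) (x - z)]; split.
- apply/convexP => x y t /= hx hy /andP[t0 t1].
  have -> : t *: x + (1 - t) *: y - z = t *: (x - z) + (1 - t) *: (y - z).
    by apply/rowP => k; rewrite !mxE; ring.
  rewrite (dotDr (t *: (x - z))) !dotZr; move: hx hy; set D := dot (p - z) (p - z) => hx hy.
  have : t * D + (1 - t) * D <= t * dot (p - z) (x - z) + (1 - t) * dot (p - z) (y - z).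
    by apply: lerD; apply: ler_wpM2l; rewrite ?subr_ge0.
  by rewrite -mulrDl addrC subrK mul1r.
- by rewrite /= subrr -(scale0r z) dotZr mul0r => /(lt_le_trans pz); rewrite ltxx.
- move=> t nv x Xx; have [|q nq /(_ nv) hq] := nearu t; first by exists x.
  have pq : p = q.
    apply: nearest_unique (convex_convex_hull _) np _.
    by apply: nearestS nq => //; apply: sub_hull => y; left.
  rewrite pq /=; apply: nearest_halfspace nq _; first exact: convex_convex_hull.
  by apply: hull_sub; right.
Qed.

Definition drop_sample N (g : {ffun 'I_N.+1 -> T}) (j : 'I_N.+1) : {ffun 'I_N -> T} :=
  [ffun k => g (lift j k)].

Lemma bigcup_drop_sample N (g : {ffun 'I_N.+1 -> T}) j :
  (\bigcup_i X (drop_sample g j i)) `|` X (g j) = \bigcup_i X (g i).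
Proof.
apply/seteqP; split=> [x [[k _]|]|x [i _]].
- by rewrite ffunE => Xx; exists (lift j k).
- by exists j.
- have [k ->|->] := unliftP j i; last by right.
  by move=> Xx; left; exists k; rewrite ?ffunE.
Qed.

(** By Caratheodory's theorem the nearest point is in the hull of [d + 1] points;
    an index that supplies none of them can be dropped without losing it. *)
Lemma violating_few N (g : {ffun 'I_N.+1 -> T}) :
  (#|[set j | violates (drop_sample g j) (g j)]%SET| <= d.+1)%N.
Proof.
have [[j0 /asboolP[p]]|] := pselect (exists j, violates (drop_sample g j) (g j)); last first.
  move=> nex; rewrite (_ : finset _ = finset.set0) ?cards0 //; apply/setP => j.
  by rewrite !inE; apply/negP => vj; apply: nex; exists j.
rewrite bigcup_drop_sample => np _.
have [s [sz sX sp]] := caratheodory np.1.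
have [|idx idxP] := @choice _ _ (fun y i => y \in s -> X (g i) y).
  move=> y; have [ys|/negP ys] := boolP (y \in s); last by exists j0.
  by have [i _ Xi] := sX y ys; exists i.
apply: leq_trans sz; rewrite -(size_map idx).
apply: leq_trans (card_size _); apply: subset_leq_card.
apply/fintype.subsetP => j; rewrite inE => /asboolP[q].
rewrite bigcup_drop_sample => nq; rewrite -(nearest_unique (convex_convex_hull _) np nq).
apply: contra_notT => jN; apply: sub_hull sp => y ys.
have := idxP y ys; have [k ->|yj] := unliftP j (idx y).
  by exists k; rewrite ?ffunE.
by rewrite -yj map_f in jN.
Qed.

Definition insert_sample N (j : 'I_N.+1) (ht : {ffun 'I_N -> T} * T) : {ffun 'I_N.+1 -> T} :=
  [ffun i => if unlift j i is Some k then ht.1 k else ht.2].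

Lemma drop_insert_sample N j ht : drop_sample (@insert_sample N j ht) j = ht.1.
Proof. by apply/ffunP => k; rewrite !ffunE liftK. Qed.

Lemma insert_sample_at N j ht : @insert_sample N j ht j = ht.2.
Proof. by rewrite ffunE unlift_none. Qed.

(** Clarkson's sampling argument. Pairs of a sample of size [N] that misses [z]
    and of a violating set correspond, once a position is chosen, to samples of
    size [N + 1] with a violating position. Every missing sample is in many such
    pairs, while each longer sample has at most [d + 1] violating positions. *)
Lemma few_samples_miss (H N : nat) :
  (forall G : {set T}, (H * #|~: G| < #|T|)%N ->
     convex_hull (\bigcup_(t in [set` G]) X t) z) ->
  (0 < #|T|)%N ->
  (N.+1 * #|[set h : {ffun 'I_N -> T} | ~~ `[< sample_hull h z >]]%SET|
     <= H * d.+1 * #|T| ^ N)%N.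
Proof.
move=> deep T0; set bad := finset _.
pose V h := [set t | @violates N h t]%SET.
pose ess j := [set g : {ffun 'I_N.+1 -> T} | violates (drop_sample g j) (g j)]%SET.
have le_ess j : (\sum_(h in bad) #|V h| <= #|ess j|)%N.
  pose S := [set ht : {ffun 'I_N -> T} * T | (ht.1 \in bad) && (ht.2 \in V ht.1)]%SET.
  have -> : (\sum_(h in bad) #|V h|)%N = #|S|.
    rewrite -sum1_card; under eq_bigr do rewrite -sum1_card.
    by rewrite pair_big_dep; apply: eq_bigl => ht; rewrite [RHS]inE.
  rewrite -(card_imset (mem S) (f := insert_sample j)).
    apply: subset_leq_card; apply/fintype.subsetP => g /imsetP[ht].
    by rewrite !inE => /andP[_]; rewrite !inE => v ->; rewrite drop_insert_sample insert_sample_at.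
  move=> ht ht' e; apply/eqP; rewrite -pair_eqE /=; apply/andP; split; apply/eqP.
    by rewrite -(drop_insert_sample j ht) e drop_insert_sample.
  by rewrite -(insert_sample_at j ht) e insert_sample_at.
have le_few : (\sum_j #|ess j| <= #|T| ^ N.+1 * d.+1)%N.
  under eq_bigr do rewrite -sum1_card big_mkcond.
  rewrite exchange_big /=.
  have <- : #|{ffun 'I_N.+1 -> T}| = (#|T| ^ N.+1)%N by rewrite card_ffun card_ord.
  rewrite -sum_nat_const; apply: leq_sum => g _; rewrite -big_mkcond sum1_card.
  apply: leq_trans (violating_few g); rewrite leq_eqVlt; apply/orP; left.
  by apply/eqP/eq_card => j; rewrite [RHS]inE [LHS]unfold_in /= [LHS]inE.
have : (N.+1 * (#|bad| * #|T|) <= H * (#|T| ^ N.+1 * d.+1))%N.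
  apply: leq_trans (leq_mul (leqnn H) le_few).
  rewrite -[X in (X * (_ * _))%N]card_ord -[leqLHS]sum_nat_const big_distrr /=; apply: leq_sum => j _.
  apply: leq_trans (leq_mul (leqnn H) (le_ess j)); rewrite big_distrr /=.
  rewrite -sum_nat_const; apply: leq_sum => h; rewrite inE => /asboolPn nhz.
  exact: violators_many.
rewrite expnS -[in X in _ -> X](leq_pmul2r T0) -[in X in _ -> X]mulnA => /leq_trans; apply.
by rewrite leq_eqVlt; apply/orP; left; apply/eqP; ring.
Qed.
End Sampling.

(** * Selection and weak nets *)

Lemma leq_card_bigcup (T : finType) (I : Type) (s : seq I) (P : pred I) (F : I -> {set T}) :
  (#|\bigcup_(i <- s | P i) F i| <= \sum_(i <- s | P i) #|F i|)%N.
Proof.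
elim/big_ind2: _ => [|n A m B le1 le2|//]; first by rewrite cards0.
exact: leq_trans (leq_card_setU _ _) (leq_add le1 le2).
Qed.

Lemma leq_exp2_base (a b n : nat) : (a <= b)%N -> (a ^ n <= b ^ n)%N.
Proof. by case: n => // n; rewrite leq_exp2r. Qed.

Section WeakNet.
Context {R : realType} {d : nat}.
Local Notation E := 'rV[R]_d.
Variables (f : set E -> \bar R) (del : R) (H C : nat).
Hypotheses (f_mono : monotone_on_convex f) (del1 : del < 1).
Hypotheses (f_helly : helly_number f del H) (f_approx : approx_number f del C).

Lemma convex_meet (I : finType) (K : I -> set E) (J : {set I}) :
  (forall i, @convex_set R E (K i)) -> @convex_set R E (meet_family K J).
Proof. by move=> cK; apply: convex_bigcap => i _; exact: cK. Qed.

(** The complements of at most [H] sets, each with fewer than [1 / (H + 1)] of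
    the elements, do not cover. *)
Lemma common_member (T : finType) (J : {set {set T}}) : (0 < #|T|)%N -> (#|J| <= H)%N ->
  exists t, forall G, G \in J -> (H.+1 * #|~: G| < #|T|)%N -> t \in G.
Proof.
move=> T0 JH; apply: contrapT => /forallNP nex.
have sub : [set: T]%SET \subset \bigcup_(G in J | (H.+1 * #|~: G| < #|T|)%N) ~: G.
  apply/fintype.subsetP => t _; have /existsNP[G /not_implyP[GJ /not_implyP[bG tG]]] := nex t.
  by apply/finset.bigcupP; exists G; rewrite ?GJ // inE; exact/negP.
have : (H.+1 * #|T| <= H * #|T|)%N.
  have := subset_leq_card sub; rewrite cardsT => le.
  apply: leq_trans (leq_mul (leqnn H.+1) (leq_trans le (leq_card_bigcup _ _ _))) _.
  rewrite big_distrr /= big_mkcondr /=; apply: leq_trans (leq_mul JH (leqnn #|T|)).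
  by rewrite -sum_nat_const; apply: leq_sum => G _; case: ifP => // /ltnW.
by rewrite leq_pmul2r // ltnn.
Qed.

(** An analogue of the centerpoint theorem: any [H] of the hulls of large
    subfamilies share a member of the family, so Helly's property applies to the
    family of all these hulls. *)
Lemma centre (T : finType) (X : T -> set E) (lam : R) : (0 < #|T|)%N -> 0 < lam ->
    (forall t, (lam%:E <= f (convex_hull (X t)))%E) ->
  exists Z, [/\ @convex_set R E Z, (((1 - del) * lam)%:E <= f Z)%E &
    forall G : {set T}, (H.+1 * #|~: G| < #|T|)%N ->
      Z `<=` convex_hull (\bigcup_(t in [set` G]) X t)].
Proof.
move=> T0 lam0 fX.
(* The small subfamilies are given the whole space, which does not affect the meet. *)
pose K (G : {set T}) : set E := if (H.+1 * #|~: G| < #|T|)%N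
  then convex_hull (\bigcup_(t in [set` G]) X t) else setT.
have cK G : @convex_set R E (K G).
  by rewrite /K; case: ifP => _; [exact: convex_convex_hull | exact: convex_setT].
exists (meet_family K [set: {set T}]%SET); split.
- exact: convex_meet.
- apply: f_helly => // J JH; have [t tJ] := common_member T0 JH.
  apply: le_trans (fX t) _; apply: f_mono; [exact: convex_convex_hull|exact: convex_meet|].
  move=> x xt G /= GJ; rewrite /K; case: ifP => // bG.
  apply: sub_hull xt => y Xy; exists t => //=; exact: tJ.
- by move=> G bG x /(_ G); rewrite /K bG /= inE; apply.
Qed.

(** At this size, [few_samples_miss] loses at most a [1 / (2 C)] part of the
    samples for each of the at most [C] vertices of an inscribed polytope. The
    bound there divides by the size plus one, hence the predecessor. *)
Definition sample_size := (2 * (C * H.+1 * d.+1).+1).-1.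

(** The centre is replaced by an inscribed polytope with at most [C] vertices,
    which is contained in the hull of a sample as soon as its vertices are. Each
    vertex is missed by few samples, and the union bound leaves at least half of
    the samples. *)
Lemma selection (T : finType) (X : T -> set E) (lam : R) : (0 < #|T|)%N -> 0 < lam ->
    (forall t, finite_set (X t)) -> (forall t, (lam%:E <= f (convex_hull (X t)))%E) ->
  exists Z, [/\ @convex_set R E Z, (((1 - del) ^+ 2 * lam)%:E <= f Z)%E &
    (#|T| ^ sample_size <=
      2 * #|[set h : {ffun 'I_sample_size -> T} | `[< Z `<=` sample_hull X h >]]%SET|)%N].
Proof.
move=> T0 lam0 finX fX; have [Z [cZ fZ Zdeep]] := centre T0 lam0 fX.
have lam'0 : 0 <= (1 - del) * lam by rewrite mulr_ge0 ?ltW // subr_gt0.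
have [P [polP PZ vP fP]] := f_approx lam'0 cZ fZ.
have [s sC Ps] := polytope_hull_seq polP vP.
exists P; split; first by rewrite Ps; exact: convex_convex_hull.
  by rewrite expr2 -mulrA.
set N := sample_size.
pose bad z := [set h : {ffun 'I_N -> T} | ~~ `[< sample_hull X h z >]]%SET.
have badz z : z \in s -> (N.+1 * #|bad z| <= H.+1 * d.+1 * #|T| ^ N)%N.
  move=> zs; apply: few_samples_miss => // G bG; apply: Zdeep => //; apply: PZ.
  by rewrite Ps; apply: hull_sub.
set good := finset _.
have sub : ~: good \subset \bigcup_(z <- s) bad z.
  apply/fintype.subsetP => h; rewrite !inE => /asboolPn nPh.
  apply: contrapT => nbad; apply: nPh; rewrite Ps; apply: hull_min => [|z zs].
    exact: convex_convex_hull.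
  apply: contrapT => nhz; apply: nbad; rewrite (big_rem z) //= inE; apply/orP; left.
  by rewrite inE; exact/asboolPn.
have leb : (N.+1 * #|~: good| <= size s * (H.+1 * d.+1 * #|T| ^ N))%N.
  apply: leq_trans (leq_mul (leqnn _)
    (leq_trans (subset_leq_card sub) (leq_card_bigcup _ _ _))) _.
  rewrite big_distrr /= -[X in (X * _)%N]count_predT -sum1_count big_distrl /=.
  by rewrite [leqLHS]big_seq [leqRHS]big_seq; apply: leq_sum => z zs; rewrite mul1n badz.
have NE : N.+1 = (2 * (C * H.+1 * d.+1).+1)%N by rewrite /N /sample_size prednK.
have := leq_trans leb (leq_mul sC (leqnn _)).
have := cardsC good; rewrite card_ffun card_ord NE -/N; move: (#|T| ^ N)%N => n <-.
set b := #|~: good|; set g := #|good|; set M := (C * H.+1 * d.+1)%N.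
have -> : (C * (H.+1 * d.+1 * (g + b)))%N = (M * (g + b))%N by rewrite /M; ring.
clearbody M; nia.
Qed.

(** The net is built greedily. If [K] contains a [1 / m] part of the family but
    no set of the current net, the selected set of that part lies in the hulls of
    at least half of the samples from it. These hulls are inside [K], so none of
    them contains an earlier set of the net: each step uses up a fixed part of
    all samples, and the number of steps is bounded. *)
Lemma weak_net (lam : R) (m : nat) : 0 < lam ->
  exists c : nat, forall (T : finType) (L : T -> set E), (0 < #|T|)%N ->
    (forall t, @convex_set R E (L t)) -> (forall t, (lam%:E <= f (L t))%E) ->
  exists (k : nat) (S : nat -> set E), [/\ (k <= c)%N,
    forall j, (j < k)%N -> @convex_set R E (S j) /\ (((1 - del) ^+ 3 * lam)%:E <= f (S j))%E &
    forall K, @convex_set R E K -> (#|T| <= m * #|[set t | `[< L t `<=` K >]]%SET|)%N ->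
      exists2 j, (j < k)%N & S j `<=` K].
Proof.
move=> lam0; set N := sample_size; exists (2 * m ^ N).+1 => T L T0 cL fL.
have lam'0 : 0 < (1 - del) * lam by rewrite mulr_gt0 // subr_gt0.
(* Hulls of finite sets are used instead of the members, so that the hull of a
   sample has a nearest point. *)
have [|X XP] := @choice T (set E) (fun t A => [/\ finite_set A,
    convex_hull A `<=` L t & (((1 - del) * lam)%:E <= f (convex_hull A))%E]).
  move=> t; have [P [[A finA ->] PL _ fP]] := f_approx (ltW lam0) (cL t) (fL t).
  by exists A.
pose good Z := @convex_set R E Z /\ (((1 - del) ^+ 3 * lam)%:E <= f Z)%E.
(* The samples whose hull contains one of the first [k] sets of the net. *)
pose cov k (S : nat -> set E) := [set h : {ffun 'I_N -> T} |
  `[< exists2 j, (j < k)%N & S j `<=` sample_hull X h >]]%SET.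
pose net k S := forall K, @convex_set R E K ->
  (#|T| <= m * #|[set t | `[< L t `<=` K >]]%SET|)%N -> exists2 j, (j < k)%N & S j `<=` K.
suff key k : (exists k' S, [/\ (k' <= k)%N, forall j, (j < k')%N -> good (S j) & net k' S]) \/
    exists2 S, forall j, (j < k)%N -> good (S j) & (k * #|T| ^ N <= 2 * m ^ N * #|cov k S|)%N.
  have [[k' [S [? ? ?]]]|[S _ le]] := key (2 * m ^ N).+1; first by exists k', S.
  exfalso; have := leq_trans le (leq_mul (leqnn _) (max_card _)).
  rewrite card_ffun card_ord leq_pmul2r ?expn_gt0 ?T0 //; last by rewrite ltnn.
elim: k => [|k [[k' [S [k'k gS nS]]]|[S gS leS]]].
- by right; exists (fun=> setT) => //; rewrite mul0n.
- by left; exists k', S; split=> //; exact: leqW.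
have [nS|/existsNP[K /not_implyP[cK /not_implyP[mK nK]]]] := pselect (net k S).
  by left; exists k, S.
right; pose D := [set t | `[< L t `<=` K >]]%SET.
have D0 : (0 < #|D|)%N by move: (leq_trans T0 mK); rewrite muln_gt0 => /andP[].
pose T' : finType := {t | t \in D}.
have cT' : #|T'| = #|D| by rewrite card_sig; apply: eq_card => t; rewrite inE.
have [||||Z [cZ fZ leZ]] := @selection T' (fun t => X (val t)) ((1 - del) * lam).
- by rewrite cT'.
- by [].
- by move=> t; have [] := XP (val t).
- by move=> t; have [] := XP (val t).
pose S' j := if j == k then Z else S j.
have SS' j : (j < k)%N -> S' j = S j by move=> jk; rewrite /S' ltn_eqF.
exists S'.
  move=> j; rewrite ltnS leq_eqVlt => /orP[/eqP->|jk]; last by rewrite SS' //; exact: gS.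
  by rewrite /S' eqxx; split=> //; rewrite exprSr -mulrA.
set G := finset _ in leZ.
pose lift' (h : {ffun 'I_N -> T'}) : {ffun 'I_N -> T} := [ffun i => val (h i)].
have liftE h : sample_hull X (lift' h) = sample_hull (fun t => X (val t)) h.
  by rewrite /sample_hull; congr convex_hull; apply: eq_bigcupr => i _; rewrite ffunE.
have lift_inj : injective lift'.
  move=> h h' /ffunP e; apply/ffunP => i; apply: val_inj.
  by have := e i; rewrite !ffunE.
have dis : cov k S :&: lift' @: G = finset.set0.
  apply/setP => h; rewrite [RHS]inE finset.in_setI; apply/negP => /andP[+ /imsetP[h' _ he]].
  rewrite {h}he.
  rewrite inE => /asboolP[j jk]; rewrite liftE => Sj; apply: nK; exists j => //.
  apply: subset_trans Sj _; apply: hull_min cK _ => x [i _ Xx].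
  have := valP (h' i); rewrite inE => /asboolP; apply.
  by have [_ + _] := XP (val (h' i)); apply; exact: hull_sub.
have sub : cov k S :|: lift' @: G \subset cov k.+1 S'.
  apply/fintype.subsetP => h; rewrite finset.in_setU => /orP[|/imsetP[h' + ->]]; rewrite inE.
    move=> /asboolP[j jk Sj]; rewrite inE; apply/asboolP; exists j; first exact: leqW.
    by rewrite SS'.
  by move=> /asboolP Zh; rewrite inE; apply/asboolP; exists k; rewrite // /S' eqxx liftE.
have leT : (#|T| ^ N <= 2 * m ^ N * #|G|)%N.
  have : (#|T| ^ N <= (m * #|D|) ^ N)%N by apply: leq_exp2_base.
  rewrite expnMn -cT' => /leq_trans; apply.
  by rewrite mulnAC mulnC leq_mul2r leZ orbT.
apply: leq_trans (leq_mul (leqnn _) (subset_leq_card sub)).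
rewrite cardsU dis cards0 subn0 card_imset // mulnDr mulSn addnC.
exact: leq_add.
Qed.

End WeakNet.

(** * Fractional Helly for weighted families *)

Lemma subset_of_card (T : finType) (A : {set T}) k : (k <= #|A|)%N ->
  exists2 B : {set T}, B \subset A & #|B| = k.
Proof.
rewrite -bin_gt0 -cards_draws card_gt0 => /set0Pn[B].
by rewrite inE => /andP[BA /eqP Bk]; exists B.
Qed.

Lemma bin_trinomial N n F : (F <= n <= N)%N ->
  ('C(N, n) * 'C(n, F) = 'C(N, F) * 'C(N - F, n - F))%N.
Proof.
move=> /andP[Fn nN]; have FN := leq_trans Fn nN.
have e1 := bin_fact nN; have e2 := bin_fact Fn; have e3 := bin_fact FN.
have e4 : ('C(N - F, n - F) * ((n - F)`! * (N - n)`!) = (N - F)`!)%N.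
  by rewrite -[in RHS](@bin_fact _ (n - F)) ?leq_sub2r // subnBA // subnK.
apply/eqP; rewrite -(eqn_pmul2r (fact_gt0 F)) -(eqn_pmul2r (fact_gt0 (n - F))).
rewrite -(eqn_pmul2r (fact_gt0 (N - n))); apply/eqP.
transitivity (N`!); last rewrite -e3 -e4; last by ring.
by rewrite -e1 -e2; ring.
Qed.

(** Double counting of the [n]-subsets by the [F]-subsets inside them. *)
Lemma supersaturation (T : finType) (n F : nat) (good : pred {set T}) :
  (F <= n <= #|T|)%N ->
  (forall J : {set T}, #|J| = n -> exists A : {set T}, [/\ A \subset J, #|A| = F & good A]) ->
  ('C(#|T|, F) <= #|[set A : {set T} | (#|A| == F) && good A]%SET| * 'C(n, F))%N.
Proof.
move=> /andP[Fn nT] hJ; set gd := finset _.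
have le : ('C(#|T|, n) <= #|gd| * 'C(#|T| - F, n - F))%N.
  rewrite -card_draws.
  pose B (A : {set T}) := [set J : {set T} | (A \subset J) && (#|J| == n)]%SET.
  have sub : [set J : {set T} | #|J| == n]%SET \subset (\bigcup_(A in gd) B A)%SET.
    apply/fintype.subsetP => J; rewrite inE => /eqP Jn; have [A [AJ AF gA]] := hJ J Jn.
    by apply/finset.bigcupP; exists A; rewrite inE ?AF ?eqxx ?AJ ?Jn ?eqxx.
  apply: leq_trans (leq_trans (subset_leq_card sub) (leq_card_bigcup _ _ _)) _.
  rewrite -sum_nat_const; apply: leq_sum => A; rewrite inE => /andP[/eqP AF _].
  have inj : {in B A &, injective (fun J : {set T} => J :\: A)}.
    move=> J J'; rewrite !inE => /andP[AJ _] /andP[AJ' _] e.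
    by rewrite -(finset.setID J A) -(finset.setID J' A) e !(finset.setIidPr _).
  rewrite -(card_in_imset inj) -AF.
  have -> : (#|T| - #|A| = #|~: A|)%N by rewrite -(cardsC A) addKn.
  rewrite -cards_draws; apply: subset_leq_card; apply/fintype.subsetP => D /imsetP[J].
  rewrite !inE => /andP[AJ /eqP Jn] ->; apply/andP; split.
    by apply/fintype.subsetP => x; rewrite !inE => /andP[].
  by rewrite cardsD (finset.setIidPr AJ) Jn.
have b0 : (0 < 'C(#|T| - F, n - F))%N by rewrite bin_gt0 leq_sub2r.
rewrite -(leq_pmul2r b0) -bin_trinomial ?Fn //.
by rewrite mulnAC leq_mul2r le orbT.
Qed.

Section BlowUp.
Context {R : realType} {d : nat}.
Local Notation E := 'rV[R]_d.
Variables (f : set E -> \bar R) (eta : R) (F p q : nat).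
Hypotheses (f_mono : monotone_on_convex f) (f_frac : fractional_helly_number f eta F).
Hypotheses (Fq : (F <= q)%N) (qp : (q <= p)%N) (q0 : (0 < q)%N).

(** The weights are realized by repeating the members. Among [p * q] repeated
    members there are either [p] distinct ones, to which the [(p, q)] condition
    applies, or [q] copies of one member [K i], for which [1 <= f (K i)] is what
    is needed. Hence [F]-tuples with a large meet have positive density. *)
Lemma weighted_fractional_helly : exists2 beta : R, 0 < beta <= 1 & forall (I : finType) (K : I -> set E),
  (forall i, @convex_set R E (K i)) -> pq_condition f p q K ->
  forall w : I -> nat, (forall i, (0 < w i)%N -> (1 <= f (K i))%E) ->
  (p * q <= \sum_i w i)%N ->
  exists J : {set I}, beta * (\sum_i w i)%:R <= (\sum_(i in J) w i)%:R
                      /\ ((1 - eta)%:E <= f (meet_family K J))%E.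
Proof.
pose n := (p * q)%N; have p0 : (0 < p)%N := leq_trans q0 qp.
have Fn : (F <= n)%N by apply: leq_trans Fq _; rewrite leq_pmull.
have a0 : 0 < ('C(n, F)%:R)^-1 :> R by rewrite invr_gt0 ltr0n bin_gt0.
have [beta beta0 hbeta] := f_frac a0.
exists (Num.min beta 1); first by rewrite lt_min beta0 ltr01 ge_min lexx orbT.
move=> I K cK pqK w wK nw.
pose T : finType := {i : I & 'I_(w i)}.
pose K' (x : T) := K (tag x).
have cK' x : @convex_set R E (K' x) by exact: cK.
have cT : #|T| = (\sum_i w i)%N.
  rewrite card_tagged sumnE big_map big_enum /=.
  by apply: eq_bigr => i _; rewrite card_ord.
have fibre (J : {set T}) : #|J| = (\sum_(i in [set tag x | x in J]%SET)
    #|[set x in J | tag x == i]%SET|)%N.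
  rewrite -sum1_card (partition_big_imset (fun x : T => tag x)) /=.
  by apply: eq_bigr => i _; rewrite -sum1_card; apply: eq_bigl => x; rewrite inE.
have fibre_le (J : {set T}) i : (#|[set x in J | tag x == i]%SET| <= w i)%N.
  rewrite -[leqRHS]card_ord; apply: leq_trans (leq_imset_card (existT (fun i => 'I_(w i)) i) _).
  apply: subset_leq_card; apply/fintype.subsetP => -[i' j]; rewrite inE /= => /andP[_ /eqP e].
  by subst i'; apply/imsetP; exists j.
have dense (J : {set T}) : #|J| = n ->
    exists A : {set T}, [/\ A \subset J, #|A| = F & (1 <= f (meet_family K' A))%E].
  move=> Jn; have [leim|ltim] := leqP p #|[set tag x | x in J]%SET|.
    have [J0 J0J J0p] := subset_of_card leim.
    have [A1 [A1J A1q fA1]] := pqK _ J0p.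
    have [A0 A0A1 A0F] : exists2 A0 : {set I}, A0 \subset A1 & #|A0| = F.
      by apply: subset_of_card; rewrite A1q.
    have [x0 x0J] : exists x0, x0 \in J by apply/set0Pn; rewrite -card_gt0 Jn muln_gt0 p0.
    (* [sec] lifts an index to one of its copies in [J], with [x0] as a default. *)
pose sec i := odflt x0 [pick x in J | tag x == i].
    have secP i : i \in A0 -> sec i \in J /\ tag (sec i) = i.
      move=> iA; have /imsetP[x xJ ix] : i \in [set tag x | x in J]%SET.
        by apply: (fintype.subsetP (fintype.subset_trans (fintype.subset_trans A0A1 A1J) J0J)).
      rewrite /sec; case: pickP => [y /andP[yJ /eqP yi]//|/(_ x)].
      by rewrite xJ ix eqxx.
    exists [set sec i | i in A0]%SET; split.
    - by apply/fintype.subsetP => x /imsetP[i /secP[? _] ->].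
    - rewrite card_in_imset // => i j /secP[_ ei] /secP[_ ej] e.
      by rewrite -ei e.
    - apply: le_trans fA1 _; apply: f_mono; [exact: convex_meet|exact: convex_meet|].
      move=> y yA x /= /imsetP[i iA ->]; rewrite /K' (secP i iA).2.
      by apply: yA => /=; exact: (fintype.subsetP A0A1).
  have [i fi] : exists i, (q <= #|[set x in J | tag x == i]%SET|)%N.
    apply: contrapT => /forallNP lt; move: (Jn); rewrite fibre => e.
    have : (n <= #|[set tag x | x in J]%SET| * q)%N.
      rewrite -e -sum_nat_const; apply: leq_sum => i _; apply: ltnW.
      by rewrite ltnNge; apply/negP/lt.
    by rewrite leq_pmul2r // leqNgt ltim.
  have [A AJ AF] := subset_of_card (leq_trans Fq fi); exists A; split=> //.
    by apply: fintype.subset_trans AJ _; apply/fintype.subsetP => x; rewrite inE => /andP[].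
  apply: le_trans (wK i (leq_trans q0 (leq_trans fi (fibre_le _ _)))) _.
  apply: f_mono; [exact: cK|exact: convex_meet|].
  move=> y Ky x /= /(fintype.subsetP AJ); rewrite inE => /andP[_ /eqP xi].
  by rewrite /K' xi.
have nT : (n <= #|T|)%N by rewrite cT.
have [|||J [bJ fJ]] := hbeta T K'.
- by move=> x; exact: cK.
- exact: leq_trans Fn nT.
- rewrite mulrC ler_pdivrMr ?ltr0n ?bin_gt0 // -natrM ler_nat.
  by apply: supersaturation; rewrite ?Fn.
exists [set tag x | x in J]%SET; split.
  rewrite -cT; apply: le_trans (_ : beta * #|T|%:R <= _).
    by rewrite ler_wpM2r // ge_min lexx.
  apply: le_trans bJ _; rewrite ler_nat fibre; apply: leq_sum => i _; exact: fibre_le.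
apply: le_trans fJ _; apply: f_mono; [exact: convex_meet|exact: convex_meet|].
by move=> y yJ i /= /imsetP[x xJ ->]; exact: yJ.
Qed.

End BlowUp.

(** * Multiplicative weights *)

Section MultiplicativeWeights.
Context {R : realType}.
Variables (I : finType) (G : {set I}) (good : {set I} -> Prop) (beta : R) (n0 : nat).
Hypothesis beta01 : 0 < beta <= 1.
Hypothesis heavy : forall w : I -> nat, (forall i, (0 < w i)%N -> i \in G) ->
  (n0 <= \sum_i w i)%N ->
  exists J : {set I}, beta * (\sum_i w i)%:R <= (\sum_(i in J) w i)%:R /\ good J.

Let cnt (s : seq {set I}) (i : I) : nat := count (fun J : {set I} => i \in J) s.
Let half : R := 2^-1.

(** The multiplicative weights method, in place of linear programming duality.
    Each round finds a good [J] that is heavy for the current weights and halves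
    the weights of its elements, so that the total weight decays geometrically. *)
Lemma halving t : G != finset.set0 -> exists s : seq {set I}, [/\ size s = t,
  forall J, J \in s -> good J &
  \sum_(i in G) half ^+ cnt s i <= #|G|%:R * (1 - beta / 2) ^+ t].
Proof.
move=> G0; elim: t => [|t [s [szs gs IH]]].
  exists [::]; split=> //; rewrite expr0 mulr1 -sum1_card natr_sum.
  by apply: ler_sum.
(* The current weights, scaled so as to be integers with a sum of at least [n0]. *)
pose w i := if i \in G then (n0.+1 * 2 ^ (t - cnt s i))%N else 0%N.
have wE i : i \in G -> (w i)%:R = (n0.+1 * 2 ^ t)%:R * half ^+ cnt s i :> R.
  move=> iG; rewrite /w iG !natrM -mulrA; congr (_ * _).
  rewrite !natrX expfB_cond ?pnatr_eq0 ?exprVn //.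
  by rewrite (leq_trans (count_size _ _)) ?szs //.
have [||J [heavyJ gJ]] := heavy (w := w).
- by move=> i; rewrite /w; case: ifP.
- have [i iG] := set0Pn _ G0; rewrite (bigD1 i) //=; apply: leq_trans (leq_addr _ _).
  by rewrite /w iG mulSn (leq_trans _ (leq_addl _ _)) // leq_pmulr ?expn_gt0.
exists (J :: s); split; first by rewrite /= szs.
  by move=> J'; rewrite inE => /orP[/eqP->//|]; exact: gs.
have c0 : 0 < (n0.+1 * 2 ^ t)%:R :> R by rewrite ltr0n muln_gt0 expn_gt0.
have sw (D : {set I}) : (\sum_(i in D) w i)%:R =
    (n0.+1 * 2 ^ t)%:R * \sum_(i in G | i \in D) half ^+ cnt s i :> R.
  rewrite natr_sum mulr_sumr (bigID (mem G)) /= [X in _ + X]big1 ?addr0.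
    by apply: eq_big => [i|i /andP[_ iG]]; [exact: andbC | rewrite wE].
  by move=> i /andP[_ /negPf iG]; rewrite /w iG.
have {}heavyJ : beta * \sum_(i in G) half ^+ cnt s i <=
    \sum_(i in G | i \in J) half ^+ cnt s i.
  move: heavyJ; rewrite sw; have -> : (\sum_i w i = \sum_(i in [set: I]%SET) w i)%N.
    by apply: eq_bigl => i; rewrite inE.
  rewrite sw mulrCA ler_pM2l //; congr (_ * _ <= _).
  by apply: eq_bigl => i; rewrite inE andbT.
have -> : \sum_(i in G) half ^+ cnt (J :: s) i =
    \sum_(i in G) half ^+ cnt s i - half * \sum_(i in G | i \in J) half ^+ cnt s i.
  rewrite mulr_sumr [X in _ - X]big_mkcondr -sumrB; apply: eq_bigr => i _ /=.
  case: ifP => _; last by rewrite add0n subr0.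
  rewrite add1n exprS /half; lra.
rewrite exprSr mulrA; apply: le_trans (ler_wpM2r _ IH); last by move/andP: beta01 => []; lra.
rewrite /half in heavyJ *; lra.
Qed.

(** After [m * k] rounds with [k = #|G|], the total weight is at most
    [k * 4 ^- k < 2 ^- k]; an element of [G] chosen fewer than [k] times would
    alone weigh more than that. *)
Lemma fractional_cover m : (1 - beta / 2) ^+ m <= 4^-1 ->
  exists (k : nat) (s : seq {set I}), [/\ size s = (m * k)%N,
   forall J, J \in s -> good J, forall i, i \in G -> (k <= cnt s i)%N
   & G != finset.set0 -> (0 < k)%N].
Proof.
move=> bm; have [->|G0] := eqVneq G finset.set0.
  by exists 0%N, [::]; split=> //; rewrite muln0.
have [s [szs gs le]] := halving (m * #|G|) G0.
exists #|G|, s; split=> //; last by rewrite card_gt0.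
move=> i iG; rewrite leqNgt; apply/negP => lt.
have h0 : 0 < half by rewrite invr_gt0.
have h1 : half <= 1 by rewrite /half invf_le1 ?ler1n.
have b0 : 0 <= 1 - beta / 2 by move/andP: beta01 => []; lra.
have : half ^+ #|G| <= #|G|%:R * (half ^+ #|G| * half ^+ #|G|).
  apply: le_trans (_ : half ^+ cnt s i <= _).
    exact: (ler_wiXn2l (ltW h0) h1 (ltnW lt)).
  apply: le_trans (_ : \sum_(i in G) half ^+ cnt s i <= _).
    by rewrite (bigD1 i) //= lerDl sumr_ge0 // => j _; rewrite exprn_ge0 // ltW.
  apply: le_trans le _; rewrite ler_wpM2l // exprM -exprMn.
  have -> : half * half = 4^-1 by rewrite /half; field.
  by apply: lerXn2r => //; rewrite nnegrE ?exprn_ge0 // invr_ge0.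
rewrite mulrA -[leLHS]mul1r ler_pM2r ?exprn_gt0 // exprVn.
rewrite ler_pdivlMr ?exprn_gt0 // mul1r -natrX ler_nat.
by rewrite leqNgt ltn_expl.
Qed.
End MultiplicativeWeights.

(** * The (p, q) property *)

Lemma small_power (R : realType) (x : R) : 0 <= x < 1 -> exists m, x ^+ m <= 4^-1.
Proof.
move=> /andP[x0 x1]; have x1' : `|x| < 1 by rewrite ger0_norm.
have /cvgrPdist_le/(_ 4^-1) := cvg_expr x1'.
rewrite invr_gt0 ltr0n => /(_ isT)[m _ /(_ m (leqnn m))] /=.
rewrite sub0r normrN => le; exists m; exact: le_trans (ler_norm _) le.
Qed.

Section PQ.
Context {R : realType} {d : nat}.
Local Notation E := 'rV[R]_d.
Variables (f : set E -> \bar R) (eps eta del : R) (H C F p q : nat).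
Hypotheses (f_mono : monotone_on_convex f) (f_frac : fractional_helly_number f eta F).
Hypotheses (del1 : del < 1) (f_helly : helly_number f del H).
Hypothesis f_approx : approx_number f del C.
Hypotheses (eta1 : eta < 1) (eta_eps : 1 - eps <= 1 - eta).
Hypothesis eps_loss : 1 - eps <= (1 - del) ^+ 3 * (1 - eta).
Hypotheses (Fq : (F <= q)%N) (qp : (q <= p)%N).

(** The [(p, 0)] condition concerns [f setT] alone. If [1 <= f setT], fractional
    Helly with [F = 0], applied to the empty set alone, makes the empty set large
    enough to be a transversal; otherwise the condition bounds the size of the
    family. *)
Lemma pq_property_q0 : q = 0%N -> pq_property f eps p q.
Proof.
move=> q0; have F0 : F = 0%N by apply/eqP; rewrite -leqn0 -q0.
have [fT|fT] := boolP (1 <= f setT)%E.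
  exists 1%N => I K cK fK pqK; exists 1%N, (fun=> set0); split=> //; last first.
    by move=> i; exists ord0.
  move=> _; split; first exact: convex_set0.
  have [beta b0 hb] := f_frac (ltr01 : 0 < 1 :> R).
  have [||| J [bJ fJ]] := hb unit (fun=> set0).
  - by move=> _; exact: convex_set0.
  - by rewrite F0.
  - rewrite F0 bin0 mulr1 ler1n card_gt0; apply/set0Pn; exists finset.set0.
    rewrite inE cards0 eqxx /=; rewrite (_ : meet_family _ _ = setT) //.
    by apply/seteqP; split=> // x _ i /=; rewrite inE.
  have [i iJ] : exists i, i \in J.
    by apply/set0Pn; rewrite -card_gt0 -(ltr0n R) (lt_le_trans _ bJ) // card_unit mulr1.
  apply: le_trans (_ : ((1 - eta)%:E <= _)%E); first by rewrite lee_fin.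
  apply: le_trans fJ _; apply: f_mono; [exact: convex_meet (fun=> convex_set0)|exact: convex_set0|].
  by move=> x /(_ i iJ).
exists p => I K cK fK pqK.
have ltI : (#|I| <= p)%N.
  rewrite leqNgt; apply/negP => ltp; have [|J _ Jp] := @subset_of_card I [set: I]%SET p.
    by rewrite cardsT ltnW.
  have [A [_ Aq fA]] := pqK J Jp; move/negP: fT; apply.
  apply: le_trans fA _; by apply: f_mono; [exact: convex_meet|exact: convex_setT|].
exists #|I|, (fun j => K (enum_val j)); split=> // i.
by exists (enum_rank i); rewrite enum_rankK.
Qed.

(** A [q]-subset of [p] members with [f] below 1 would meet in a set with [f] at
    least 1. *)
Lemma few_bad (I : finType) (K : I -> set E) : (0 < q)%N ->
  (forall i, @convex_set R E (K i)) -> pq_condition f p q K ->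
  (#|[set i | ~~ (1 <= f (K i))%E]%SET| <= p)%N.
Proof.
move=> q0 cK pqK; rewrite leqNgt; apply/negP => /ltnW/subset_of_card[J JB Jp].
have [A [AJ Aq fA]] := pqK J Jp.
have [i iA] : exists i, i \in A by apply/set0Pn; rewrite -card_gt0 Aq.
have := fintype.subsetP JB _ (fintype.subsetP AJ _ iA); rewrite inE => /negP; apply.
by apply: le_trans fA _; apply: f_mono; [exact: convex_meet|exact: cK|move=> x; exact].
Qed.

(** The members on which [f] is less than 1 are not covered by the weighting
    argument, but there are at most [p] of them, and each serves as its own
    element of the transversal. *)
Lemma pq_property_of_numbers : pq_property f eps p q.
Proof.
have [q0|q0] := posnP q; first exact: pq_property_q0.
have [beta beta01 heavy] := weighted_fractional_helly f_mono f_frac Fq qp q0.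
have [|m bm] := @small_power R (1 - beta / 2).
  by apply/andP; move/andP: beta01 => []; split; lra.
have lam0 : 0 < 1 - eta by rewrite subr_gt0.
have [c net] := weak_net f_mono del1 f_helly f_approx m lam0.
exists (p + c)%N => I K cK fK pqK.
pose bad := [set i | ~~ (1 <= f (K i))%E]%SET.
have badp : (#|bad| <= p)%N by exact: few_bad.
have [k [S [kc fS coverS]]] : exists (k : nat) (S : nat -> set E), [/\ (k <= c)%N,
    forall j, (j < k)%N -> @convex_set R E (S j) /\ ((1 - eps)%:E <= f (S j))%E
    & forall i, i \notin bad -> exists2 j, (j < k)%N & S j `<=` K i].
  have [|k [s [szs gs ks k0]]] := @fractional_cover R I (~: bad)
    (fun J => ((1 - eta)%:E <= f (meet_family K J))%E) beta (p * q) beta01 _ m bm.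
    by move=> w wG nw; apply: heavy => // i /wG; rewrite !inE negbK.
  have [allbad|G0] := eqVneq (~: bad) finset.set0.
    exists 0%N, (fun=> setT); split=> // i ib.
    have : i \in ~: bad by rewrite finset.in_setC.
    by rewrite allbad inE.
  pose L (t : 'I_(size s)) := meet_family K (nth finset.set0 s t).
  have [|||k' [S [kc fS netS]]] := net _ L.
  - rewrite card_ord szs muln_gt0 (k0 G0) andbT.
    rewrite lt0n; apply: contraTneq bm => ->; rewrite expr0 -ltNge.
    by rewrite invf_lt1 ?ltr1n.
  - by move=> t; exact: convex_meet.
  - by move=> t; apply: gs; rewrite mem_nth.
  exists k', S; split=> //.
    move=> j jk; have [cS fSj] := fS j jk; split=> //.
    by apply: le_trans fSj; rewrite lee_fin.
  move=> i ib; apply: netS => //; rewrite [leqLHS]card_ord [leqLHS]szs leq_mul2l.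
  have iG : i \in ~: bad by rewrite finset.in_setC.
  apply/orP; right; apply: leq_trans (ks i iG) _.
  rewrite -sum1_count (big_nth finset.set0) big_mkord sum1_card.
  apply: subset_leq_card; apply/fintype.subsetP => t; rewrite unfold_in inE => it.
  by apply/asboolP => x; apply.
exists (#|bad| + k)%N, (fun j => match fintype.split j with
  | inl a => K (enum_val a) | inr b => S b end); split.
- exact: leq_add.
- move=> j; case: fintype.splitP => [a _|b _]; last exact: fS.
  by split; [exact: cK | exact: fK].
- move=> i; have [ib|/coverS[j jk Sj]] := boolP (i \in bad).
    exists (lshift k (enum_rank_in ib i)).
    by rewrite (unsplitK (inl _)) enum_rankK_in.
  by exists (rshift #|bad| (Ordinal jk)); rewrite (unsplitK (inr _)).
Qed.

End PQ.

Theorem theorem2p4 (R : realType) (d : nat) (f : set 'rV[R]_d -> \bar R)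
    (f_ge0 : nonneg_on_convex f) (f_mono : monotone_on_convex f) :
  (admits_helly f -> admits_approx f -> admits_fractional_helly f ->
   forall eps : R, 0 < eps < 1 ->
   forall F : nat, fractional_helly_number f (eps / 2) F ->
   forall p q : nat, (F <= q <= p)%N -> pq_property f eps p q)
  /\
  (admits_sharp_helly f -> admits_sharp_approx f ->
   admits_sharp_fractional_helly f ->
   forall F : nat, fractional_helly_number f 0 F ->
   forall p q : nat, (F <= q <= p)%N -> pq_property f 0 p q).
Proof.
split=> [hH hC _ eps /andP[e0 e1] F hF p q /andP[Fq qp]|[H hH] [C hC] _ F hF p q /andP[Fq qp]].
- have de : 0 < eps / 6 < 1 by apply/andP; split; lra.
  have [H hH'] := hH _ de; have [C hC'] := hC _ de.
  apply: (@pq_property_of_numbers R d f eps (eps / 2) (eps / 6) H C F) => //; try lra.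
  (* The three losses of [eps / 6] amount to at most [eps / 2]. *)
  have h : 1 - eps / 2 <= (1 - eps / 6) ^+ 3 by nra.
  apply: le_trans (_ : (1 - eps / 2) * (1 - eps / 2) <= _); first by nra.
  by apply: ler_wpM2r => //; lra.
- apply: (@pq_property_of_numbers R d f 0 0 0 H C F) => //; rewrite ?ltr01 //.
  by rewrite subr0 expr1n mulr1.
Qed.
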